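(* Let $p\in\mathbb{Z}^n$ have positive components, $r\in\mathbb{Z}^n$, $M$ an integer, and let $a=pM+r$ have positive components. Suppose that $p$ and $r$ are not parallel. Let $u$ be a vector each of whose components is a positive integer or $+\infty$, let $0<\beta<au$, and consider $$\text{(KP)}\quad ax=\beta,\ 0\le x\le u,\ x\in\mathbb{Z}^n,\qquad \text{(KP-N)}\quad 0\le V\lambda+x_\beta\le u,\ \lambda\in\mathbb{Z}^{n-1},$$ where the columns of $V$ form a reduced basis of $\{v\in\mathbb{Z}^n : av=0\}$ computed by a basis reduction method with reduction factor $c_n$, and $x_\beta\in\mathbb{Z}^n$ satisfies $ax_\beta=\beta$. Let $\hat p=pV$. Then: 1. Let $1\le k\le n-2$ and suppose $M>2c_n\|r\|^2\alpha_{k+1}^2$. Then $\hat p_1=\dots=\hat p_k=0$. Also, if the infeasibility of (KP) is proven by branching on $px$, then the infeasibility of (KP-N) is proven by branching on $\lambda_{k+1},\dots,\lambda_{n-1}$. 2. Suppose $M>2c_n\|r\|^2\|p\|^2$. Then $\hat p_1=\dots=\hat p_{n-2}=0$, and $$\operatorname{width}(e_{n-1},\text{(KP-N)})\le\operatorname{width}(p,\text{(KP)}),\qquad \operatorname{iwidth}(e_{n-1},\text{(KP-N)})\le\operatorname{iwidth}(p,\text{(KP)}).$$ In particular, in the AHL reformulation of $\text{(KP-EQ)}$: $ax=\beta$, $x\ge0$, $x\in\mathbb{Z}^n$ (i.e. in (KP-N) with all $u_i=+\infty$) the width and the integer width in the direction of $e_{n-1}$ are $\Theta(\beta/M^2)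$.
   Context: $\|\cdot\|$ is the Euclidean norm; $px$, $ax$, $au$ are inner products ($au=+\infty$ if some $u_i=+\infty$); $e_{n-1}$ is the last unit vector of $\mathbb{R}^{n-1}$. The LP relaxation is obtained by dropping integrality. (KP-N) is called the AHL reformulation of (KP). $\alpha_k=\Lambda_k(\{v\in\mathbb{Z}^n : pv=0\})$ for $k=1,\dots,n-1$, where for a lattice $L$, $\Lambda_k(L)$ is the smallest $t$ such that $L$ contains $k$ linearly independent vectors of norm at most $t$. Reduction factor: a basis reduction method has reduction factor $c_n$ (a constant depending only on $n$) if for every lattice of rank $s\le n$ and every reduced basis $b_1,\dots,b_s$ of it, $$\max\{\|b_1\|,\dots,\|b_i\|\}\le c_n\max\{\|d_1\|,\dots,\|d_i\|\}$$ for all $i\le s$ and all linearly independent $d_1,\dots,d_i$ in the lattice. The infeasibility of an integer program is proven by branching on $px$ if $px$ is nonintegral for all $x$ in its LP relaxation; it is proven by branching on $\lambda_{k+1},\dots,\lambda_{n-1}$ if no $\lambda$ in its LP relaxation has all of $\lambda_{k+1},\dots,\lambda_{n-1}$ integral. For a polyhedron $Q$ and integral $c$, $\operatorname{width}(c,Q)=\max_{x\in Q}cx-\min_{x\in Q}cx$ and $\operatorname{iwidth}(c,Q)=\lfloor\max_{x\in Q}cx\rfloor-\lceil\min_{x\in Q}cx\rceil+1$; for an integer program (P), $\operatorname{width}(c,\text{(P)})$ and $\operatorname{iwidth}(c,\text{(P)})$ refer to its LP relaxation. $\Theta(\beta/M^2)$ means bounded below and above by positive constant multiples of $\beta/M^2$,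 where the constants depend on $p$ and $r$.
   Formalization: The integer width is shown to be Θ(β/M²) only when β/M² ≥ K, for a constant K > 0 depending on p and r; without a threshold this is false (p=(1,1), r=(1,0), β=M+1, x_β=e_1 gives integer width 1 while β/M² → 0). *)

(* Defs.v *)
From HB Require Import structures.
From mathcomp Require Export all_boot all_order all_algebra.
From mathcomp Require Export all_classical all_reals.

Set Implicit Arguments.
Unset Strict Implicit.
Unset Printing Implicit Defensive.

Import Order.TTheory GRing.Theory Num.Theory.

Local Open Scope classical_set_scope.
Local Open Scope ring_scope.

(* The real numbers are an arbitrary R : realType.  Objective and constraint vectors (p, r, a, c) are row vectors, points of a
   polyhedron and lattice vectors are column vectors.  All indices are
   0-based: the coordinates numbered k+1, ..., m are those j : 'I_m with
   k <= j. *)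

Section Definitions.
Variable R : realType.

Definition toR m n (A : 'M[int]_(m, n)) : 'M[R]_(m, n) :=
  map_mx (fun z : int => z%:~R) A.

Definition dot n (c : 'rV[R]_n) (x : 'cV[R]_n) : R := (c *m x) 0 0.

(* Only used on row and column vectors, where it is the Euclidean norm. *)
Definition enorm m n (v : 'M[R]_(m, n)) : R :=
  Num.sqrt (\sum_i \sum_j v i j ^+ 2).

Definition parallel n (x y : 'rV[R]_n) : Prop :=
  (exists t : R, x = t *: y) \/ (exists t : R, y = t *: x).

(* The largest and the smallest element of a set of reals (0 if none).  They
   exist wherever these are used below: nonempty polytopes, and norms of
   vectors of a lattice of integer points. *)
Definition set_max (A : set R) : R := xget 0 [set t | A t /\ ubound A t].
Definition set_min (A : set R) : R := xget 0 [set t | A t /\ lbound A t].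

Definition lattice_of m s (B : 'M[R]_(m, s)) : set 'cV[R]_m :=
  [set B *m toR z | z in [set: 'cV[int]_s]].

Definition basis_of_lattice m s (B : 'M[R]_(m, s)) (L : set 'cV[R]_m) : Prop :=
  \rank B = s /\ lattice_of B = L.

Definition null_lattice n (a : 'rV[int]_n) : set 'cV[R]_n :=
  [set toR v | v in [set v : 'cV[int]_n | a *m v = 0]].

(* The k-th successive minimum Lambda_k(L), for k >= 1. *)
Definition succ_min n (k : nat) (L : set 'cV[R]_n) : R :=
  set_min [set t | exists D : 'M[R]_(n, k),
    [/\ \rank D = k, forall j, L (col j D) & forall j, enorm (col j D) <= t]].

(* A basis reduction method is represented by its notion of reduced basis, a
   predicate on the matrices whose columns are the basis vectors. *)
Definition reduction_method : Type := forall m s : nat, 'M[R]_(m, s) -> Prop.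

Definition has_reduction_factor (red : reduction_method) (n : nat) (c : R) :
    Prop :=
  forall (m s : nat) (B : 'M[R]_(m, s)), (s <= n)%N -> \rank B = s ->
  red m s B ->
  forall (i : nat) (D : 'M[R]_(m, i)), (1 <= i <= s)%N -> \rank D = i ->
  (forall j, lattice_of B (col j D)) ->
  \big[Num.max/0]_(j < s | (j < i)%N) enorm (col j B) <=
  c * \big[Num.max/0]_(j < i) enorm (col j D).

Definition box n (u : 'I_n -> \bar R) : set 'cV[R]_n :=
  [set x | forall i, 0 <= x i 0 /\ ((x i 0)%:E <= u i)%E].

Definition KP_LP n (a : 'rV[int]_n) (beta : int) (u : 'I_n -> \bar R) :
    set 'cV[R]_n :=
  [set x | dot (toR a) x = beta%:~R /\ box u x].

Definition KPN_LP n m (V : 'M[int]_(n, m)) (xb : 'cV[int]_n)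
    (u : 'I_n -> \bar R) : set 'cV[R]_m :=
  [set l | box u (toR V *m l + toR xb)].

(* Infeasibility proven by branching on cx, resp. on the variables of 0-based
   index >= k, for an integer program with LP relaxation Q. *)
Definition infeasible_by_branching_on n (c : 'rV[int]_n) (Q : set 'cV[R]_n) :
    Prop :=
  forall x, Q x -> dot (toR c) x \isn't a Num.int.

Definition infeasible_by_branching_from n (k : nat) (Q : set 'cV[R]_n) : Prop :=
  ~ exists l, Q l /\ forall j : 'I_n, (k <= j)%N -> l j 0 \is a Num.int.

Definition max_over n (c : 'rV[int]_n) (Q : set 'cV[R]_n) : R :=
  set_max [set dot (toR c) x | x in Q].

Definition min_over n (c : 'rV[int]_n) (Q : set 'cV[R]_n) : R :=
  set_min [set dot (toR c) x | x in Q].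

Definition width n (c : 'rV[int]_n) (Q : set 'cV[R]_n) : R :=
  max_over c Q - min_over c Q.

Definition iwidth n (c : 'rV[int]_n) (Q : set 'cV[R]_n) : int :=
  Num.floor (max_over c Q) - Num.ceil (min_over c Q) + 1.

End Definitions.

Arguments toR R {m n} A.
Arguments null_lattice R {n} a.

Definition last_unit m : 'rV[int]_m := \row_j (j.+1 == m)%:R.

(* Main.v *)
Require Import Defs.
From mathcomp Require Import all_boot all_order all_algebra.
From mathcomp Require Import all_classical all_reals.
From mathcomp Require Import topology normedtype derive.
From mathcomp Require Import zify ring lra.

Set Implicit Arguments.
Unset Strict Implicit.
Unset Printing Implicit Defensive.

Import Order.TTheory GRing.Theory Num.Theory.
Import numFieldNormedType.Exports.

Local Open Scope classical_set_scope.
Local Open Scope ring_scope.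

(** Why the theorem holds. Write [a = M p + r]. On a vector [b] of the null
    lattice of [a], [a b = 0] says [M (p b) = - r b]; as [p b] is an integer, it
    vanishes as soon as [|r| |b| < M]. So the claim on [p V] only needs the first
    reduced basis vectors to be short, and by the reduction factor this follows
    from [k] independent short vectors of that lattice. These come from [k + 1]
    independent vectors [v_i] of the null lattice of [p] with norm at most [t]:
    eliminating [r] between pairs of them gives [k] independent vectors
    orthogonal to both [p] and [r], hence to [a], of norm at most [2 |r| t^2]
    ([short_vectors_orthogonal_to_both], [reduced_orthogonal_to_p]). Part 1 takes
    for [t] the successive minimum. Part 2 takes [t = |p|], which is enough for
    all of [n - 1] vectors because [p_n e_i - p_i e_n] has norm at most [|p|].

    The map [l |-> V l + x_beta] is a bijection between the two relaxations
    ([KP_LP_is_image]), and [p (V l + x_beta) = (p V) l + p x_beta]. With the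
    first [k] entries of [p V] equal to 0, integral values of the other
    variables give an integral [p x]: this is the branching claim. When only the
    last entry [q] of [p V] can be nonzero, the values of [p x] are those of
    [q l + c], for [l] the last variable and [c] an integer. The width is thus
    divided by [|q|], and the number of integers in the interval does not
    increase when one goes back through an integral affine map
    ([spans_affine_preimage]).

    For the order of magnitude with all [u_i] infinite, [q] has to be bounded
    independently of [M]. The vector [a_j e_i - a_i e_j] lies in the null lattice
    of [a], and [p] takes on it the value [p_i r_j - p_j r_i], in which [M] has
    cancelled; so [q] divides every such minor ([last_entry_dvd_minor]), and one
    of them is nonzero because [p] and [r] are not parallel. The same minor
    measures how far apart [p] is at two vertices of the simplex [a x = beta],
    [x >= 0], and [q] cancels against it ([last_width_bounds]). *)

(** * Euclidean norm and column rank *)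

Section Vectors.
Variable R : realType.

Lemma toR_mul m n k (A : 'M[int]_(m, n)) (B : 'M[int]_(n, k)) :
  toR R (A *m B) = toR R A *m toR R B.
Proof. exact: (map_mxM (intmul 1 : {rmorphism int -> R})). Qed.

Lemma toR_inj m n : injective (@toR R m n).
Proof.
move=> A B /matrixP AB; apply/matrixP => i j.
by have := AB i j; rewrite !mxE => /intr_inj.
Qed.

Lemma toR0 m n : toR R (0 : 'M_(m, n)) = 0.
Proof. by apply/matrixP => i j; rewrite !mxE. Qed.

Lemma col_toR m n (A : 'M[int]_(m, n)) j : col j (toR R A) = toR R (col j A).
Proof. by apply/matrixP => i k; rewrite !mxE. Qed.

Lemma col_mulmx (S : pzSemiRingType) m n k (A : 'M[S]_(m, n)) (B : 'M_(n, k)) j :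
  col j (A *m B) = A *m col j B.
Proof.
by apply/matrixP => i l; rewrite !mxE; apply: eq_bigr => x _; rewrite mxE.
Qed.

Lemma dotE n (c : 'rV[R]_n) x : dot c x = \sum_i c 0 i * x i 0.
Proof. by rewrite /dot mxE. Qed.

Lemma dot_toR n (c : 'rV[int]_n) (x : 'cV[int]_n) :
  dot (toR R c) (toR R x) = ((c *m x) 0 0)%:~R.
Proof. by rewrite /dot -toR_mul mxE. Qed.

Lemma enorm_ge0 m n (v : 'M[R]_(m, n)) : 0 <= enorm v.
Proof. exact: sqrtr_ge0. Qed.

Lemma sqr_enorm m n (v : 'M[R]_(m, n)) :
  enorm v ^+ 2 = \sum_i \sum_j v i j ^+ 2.
Proof.
rewrite sqr_sqrtr //.
by apply: sumr_ge0 => i _; apply: sumr_ge0 => j _; exact: sqr_ge0.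
Qed.

Lemma sqrtr_sqr_enorm m n (v : 'M[R]_(m, n)) : Num.sqrt (enorm v ^+ 2) = enorm v.
Proof. by rewrite sqr_enorm. Qed.

Lemma sqr_enorm_row n (v : 'rV[R]_n) : enorm v ^+ 2 = \sum_j v 0 j ^+ 2.
Proof. by rewrite sqr_enorm big_ord1. Qed.

Lemma sqr_enorm_col n (v : 'cV[R]_n) : enorm v ^+ 2 = \sum_i v i 0 ^+ 2.
Proof. by rewrite sqr_enorm; apply: eq_bigr => i _; rewrite big_ord1. Qed.

Lemma norm_entry_le n (v : 'rV[R]_n) i : `|v 0 i| <= enorm v.
Proof.
rewrite -ler_sqr ?nnegrE ?enorm_ge0 // real_normK ?num_real // sqr_enorm_row.
rewrite (bigD1 i) //= lerDl; apply: sumr_ge0 => j _; exact: sqr_ge0.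
Qed.

(** Lagrange's identity: after squaring, the defect is half the sum of the
    squares of the 2x2 minors. *)
Lemma cauchy_schwarz n (c : 'rV[R]_n) (x : 'cV[R]_n) :
  `|dot c x| <= enorm c * enorm x.
Proof.
rewrite -ler_sqr ?nnegrE ?mulr_ge0 ?enorm_ge0 //.
rewrite real_normK ?num_real // exprMn sqr_enorm_row sqr_enorm_col dotE.
have : 0 <= \sum_i \sum_j (c 0 i * x j 0 - c 0 j * x i 0) ^+ 2.
  by apply: sumr_ge0 => i _; apply: sumr_ge0 => j _; exact: sqr_ge0.
have -> : \sum_i \sum_j (c 0 i * x j 0 - c 0 j * x i 0) ^+ 2 =
    2 * ((\sum_i c 0 i ^+ 2) * (\sum_i x i 0 ^+ 2) -
         (\sum_i c 0 i * x i 0) ^+ 2).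
  set A := \sum_i c 0 i ^+ 2; set B := \sum_i x i 0 ^+ 2.
  set C := \sum_i c 0 i * x i 0.
  transitivity (A * B + B * A - (C * C + C * C)); last by ring.
  rewrite !big_distrlr /= -!big_split /= -sumrB; apply: eq_bigr => i _.
  rewrite -!big_split /= -sumrB; apply: eq_bigr => j _; ring.
by move=> h; lra.
Qed.

Lemma sqr_enorm_combination n (v w : 'cV[R]_n) (x y : R) :
  enorm (x *: v - y *: w) ^+ 2 <=
  2 * (x ^+ 2 * enorm v ^+ 2 + y ^+ 2 * enorm w ^+ 2).
Proof.
rewrite !sqr_enorm_col !mulr_sumr -big_split /= mulr_sumr.
apply: ler_sum => i _; rewrite !mxE.
have := sqr_ge0 (x * v i 0 + y * w i 0); nra.
Qed.

Lemma enorm_int_ge1 m n (v : 'M[int]_(m, n)) : v != 0 -> 1 <= enorm (toR R v).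
Proof.
move=> v0.
have [i [j vij]] : exists i, exists j, v i j != 0.
  apply: contrapT => h; move/eqP: v0; apply; apply/matrixP => i j.
  rewrite mxE; apply/eqP; apply: contrapT => /negP vij.
  by apply: h; exists i, j.
rewrite -(@ler_sqr R) ?nnegrE ?enorm_ge0 // expr1n sqr_enorm.
rewrite (bigD1 i) //= (bigD1 j) //= mxE.
apply: (@le_trans _ _ ((v i j)%:~R ^+ 2)).
  rewrite -rmorphXn /= (_ : 1 = 1%:~R) // ler_int.
  by rewrite -gtz0_ge1 lt_neqAle sqr_ge0 andbT eq_sym sqrf_eq0.
rewrite -addrA lerDl addr_ge0 //; first by apply: sumr_ge0 => ? _; exact: sqr_ge0.
by apply: sumr_ge0 => ? _; apply: sumr_ge0 => ? _; exact: sqr_ge0.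
Qed.

End Vectors.

Section ColumnRank.
Variable R : fieldType.

Lemma full_col_rankP m n (A : 'M[R]_(m, n)) :
  \rank A = n <-> exists C, C *m A = 1%:M.
Proof.
split; first by move=> rA; apply/row_fullP; rewrite /row_full rA.
by move/row_fullP/eqP.
Qed.

Lemma full_col_rank_mul m n k (A : 'M[R]_(m, n)) (B : 'M[R]_(n, k)) :
  \rank A = n -> \rank B = k -> \rank (A *m B) = k.
Proof.
move=> /full_col_rankP[C CA] /full_col_rankP[D DB]; apply/full_col_rankP.
by exists (D *m C); rewrite mulmxA -(mulmxA D) CA mulmx1.
Qed.

Lemma full_col_rank_colsub m n k (A : 'M[R]_(m, n)) (f : 'I_k -> 'I_n) :
  injective f -> \rank A = n -> \rank (colsub f A) = k.
Proof.
move=> injf /full_col_rankP[C CA]; apply/full_col_rankP.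
exists (rowsub f C); rewrite -mxsub_mul CA.
by apply/matrixP => i j; rewrite !mxE (inj_eq injf).
Qed.

Lemma full_col_rank_col_neq0 m n (A : 'M[R]_(m, n)) j :
  \rank A = n -> col j A != 0.
Proof.
move=> /full_col_rankP[C CA]; apply/eqP => A0.
have := congr1 (fun B : 'M_n => B j j) CA.
rewrite !mxE eqxx big1 => [/esym/eqP|i _]; first by rewrite oner_eq0.
by have := congr1 (fun B : 'cV_m => B i 0) A0; rewrite !mxE => ->; rewrite mulr0.
Qed.

End ColumnRank.

(** * Null lattices and their short vectors *)

Section NullLattices.
Variable R : realType.

Lemma null_lattice_mx n k (a : 'rV[int]_n) (D : 'M[R]_(n, k)) :
  (forall j, null_lattice R a (col j D)) ->
  exists2 Z : 'M[int]_(n, k), D = toR R Z & a *m Z = 0.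
Proof.
move=> aD.
have /choice[f fP] : forall j, exists v : 'cV[int]_n,
    a *m v = 0 /\ toR R v = col j D.
  by move=> j; have [v av vD] := aD j; exists v.
exists (\matrix_(i, j) f j i 0).
  apply/matrixP => i j; have [_ /matrixP/(_ i 0)] := fP j.
  by rewrite !mxE => ->.
apply/matrixP => i j; have [/matrixP/(_ i 0) + _] := fP j.
rewrite !mxE => avj; rewrite -[RHS]avj.
by apply: eq_bigr => l _; rewrite !mxE.
Qed.

Lemma basis_of_null_lattice n m (a : 'rV[int]_n) (V : 'M[int]_(n, m)) :
  basis_of_lattice (toR R V) (null_lattice R a) -> a *m V = 0.
Proof.
move=> [_ VL]; have [|Z /toR_inj <- //] := @null_lattice_mx _ _ a (toR R V).
move=> j; rewrite -VL; exists (delta_mx j 0) => //.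
rewrite -toR_mul col_toR; congr toR; apply/matrixP => i l.
rewrite !mxE (bigD1 j) //= !mxE !eqxx ord1 mulr1 big1 ?addr0 // => x xj.
by rewrite !mxE (negbTE xj) mulr0.
Qed.

(** Norms of integer vectors are square roots of natural numbers, so the least
    admissible bound exists as soon as one bound does. *)
Lemma succ_min_attained n k (a : 'rV[int]_n) (D0 : 'M[R]_(n, k.+1)) :
  \rank D0 = k.+1 -> (forall j, null_lattice R a (col j D0)) ->
  let t := succ_min k.+1 (null_lattice R a) in
  exists D : 'M[R]_(n, k.+1), [/\ \rank D = k.+1,
    forall j, null_lattice R a (col j D) & forall j, enorm (col j D) <= t].
Proof.
move=> rD0 aD0.
pose P (N : nat) := `[< exists D : 'M[R]_(n, k.+1), [/\ \rank D = k.+1,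
  forall j, null_lattice R a (col j D) &
  forall j, enorm (col j D) <= Num.sqrt N%:R] >].
have sqr_nat v : null_lattice R a v -> exists N : nat, enorm v = Num.sqrt N%:R.
  move=> [w _ <-]; exists `|(\sum_i w i 0 ^+ 2)%R|%N.
  rewrite natr_absz ger0_norm; last by apply: sumr_ge0 => i _; exact: sqr_ge0.
  rewrite -[LHS]sqrtr_sqr_enorm sqr_enorm_col rmorph_sum /=.
  congr Num.sqrt. by apply: eq_bigr => i _; rewrite mxE rmorphXn.
have maxP (D : 'M[R]_(n, k.+1)) : \rank D = k.+1 -> (forall j, null_lattice R a (col j D)) ->
    exists2 N, P N & exists j, enorm (col j D) = Num.sqrt N%:R.
  move=> rD aD; have /choice[f fP] := fun j => sqr_nat _ (aD j).
  have [|j fj] := @bigop.eq_bigmax 'I_k.+1 f; first by rewrite card_ord.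
  exists (\max_j f j)%N; last by exists j; rewrite fj fP.
  apply/asboolP; exists D; split=> // i.
  by rewrite fP ler_wsqrtr // ler_nat bigop.leq_bigmax.
have exP : exists N, P N by have [N PN _] := maxP _ rD0 aD0; exists N.
case: (ex_minnP exP) => N /asboolP[D [rD aD DN]] minN.
rewrite /= /succ_min /set_min.
set T := (X in xget 0 X).
suff: T (xget 0 T) by move=> [].
apply: xgetPex; exists (Num.sqrt N%:R); split; first by exists D.
move=> t [E [rE aE Et]]; have [N' /minN NN' [j jN']] := maxP E rE aE.
by apply: le_trans (Et j); rewrite jN' ler_wsqrtr // ler_nat.
Qed.

(** The vector [rho_s e_i - rho_i e_s], orthogonal to [rho]. It serves three
    times: with [rho] the values of [r] on vectors to be combined, with
    [rho = p] for short vectors of the null lattice of [p], and with [rho = a]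
    for the vectors on which [p] takes the minors of [p] and [r] as values. *)
Definition elim_vec k (rho : 'rV[int]_k) (s i : 'I_k) : 'cV[int]_k :=
  rho 0 s *: delta_mx i 0 - rho 0 i *: delta_mx s 0.

Definition elim_mx k (rho : 'rV[int]_k.+1) (s : 'I_k.+1) : 'M[int]_(k.+1, k) :=
  \matrix_(l, i) elim_vec rho s (lift s i) l 0.

Lemma mul_elim_vec n k (c : 'M[int]_(n, k)) rho s i :
  c *m elim_vec rho s i = rho 0 s *: col i c - rho 0 i *: col s c.
Proof. by rewrite mulmxBr -!scalemxAr -!colE. Qed.

Lemma col_elim_mx k (rho : 'rV[int]_k.+1) s i :
  col i (elim_mx rho s) = elim_vec rho s (lift s i).
Proof. by apply/matrixP => l j; rewrite mxE mxE ord1. Qed.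

Lemma mul_elim_mx k (rho : 'rV[int]_k.+1) s : rho *m elim_mx rho s = 0.
Proof.
apply/matrixP => o i; rewrite ord1 [RHS]mxE.
have -> : (rho *m elim_mx rho s) 0 i = (rho *m col i (elim_mx rho s)) 0 0.
  by rewrite -col_mulmx [RHS]mxE.
by rewrite col_elim_mx mul_elim_vec !mxE; ring.
Qed.

(** Up to the factor [rho_s], the rows of index other than [s] form an identity
    matrix. *)
Lemma rank_elim_mx k (rho : 'rV[int]_k.+1) s :
  rho 0 s != 0 -> \rank (toR R (elim_mx rho s)) = k.
Proof.
move=> rho_s; apply/full_col_rankP.
exists (\matrix_(i, l) ((l == lift s i)%:R / (rho 0 s)%:~R)).
apply/matrixP => i j; rewrite !mxE (bigD1 (lift s i)) //= !mxE !eqxx.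
rewrite big1 => [|l /negbTE li]; last by rewrite !mxE li !mul0r.
rewrite (inj_eq (@lift_inj _ s)) [_ == s]eq_sym (negbTE (neq_lift _ _)).
rewrite /= mulr0 subr0 addr0 andbT rmorphM rmorph_nat mul1r mulrA.
by rewrite mulVf ?mul1r // intr_eq0.
Qed.

Lemma enorm_elim_mx k (rho : 'rV[int]_k.+1) s i :
  enorm (col i (toR R (elim_mx rho s))) <= enorm (toR R rho).
Proof.
rewrite -(@ler_sqr R) ?nnegrE ?enorm_ge0 // sqr_enorm_col sqr_enorm_row.
have neq : lift s i != s by rewrite eq_sym neq_lift.
rewrite (bigD1 s) // (bigD1 (lift s i)) //= [leRHS](bigD1 s) //=.
rewrite [X in _ <= _ + X](bigD1 (lift s i)) //= big1 => [|l /andP[ls li]].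
  rewrite !mxE !eqxx (negbTE neq) eq_sym (negbTE neq) /=.
  rewrite !mulr1 !mulr0 subr0 sub0r rmorphN sqrrN addr0 addrCA addrA lerDl.
  by apply: sumr_ge0 => l _; exact: sqr_ge0.
by rewrite !mxE (negbTE ls) (negbTE li) !mulr0 subr0 expr0n.
Qed.

(** Eliminating [r] between [k.+1] independent vectors [v_i] of the null
    lattice of [p]: if [r v_s] is nonzero, the [k] vectors
    [(r v_s) v_i - (r v_i) v_s] with [i] other than [s] are independent and
    orthogonal to both [p] and [r]; if [r] kills every [v_i], the [v_i]
    themselves are, and the bound still holds because a nonzero integer vector
    has norm at least 1. The norm of a combination is bounded by
    [|x v - y w|^2 <= 2 (x^2 |v|^2 + y^2 |w|^2)], which gives the same constant
    as the triangle inequality. *)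
Lemma short_vectors_orthogonal_to_both n k (p r : 'rV[int]_n)
    (D : 'M[R]_(n, k.+1)) t :
  r != 0 -> \rank D = k.+1 -> (forall j, null_lattice R p (col j D)) ->
  (forall j, enorm (col j D) <= t) ->
  exists W : 'M[int]_(n, k), [/\ \rank (toR R W) = k, p *m W = 0, r *m W = 0 &
    forall j, enorm (col j (toR R W)) <= 2 * enorm (toR R r) * t ^+ 2].
Proof.
move=> r0 rD pD Dt; have [Z DZ pZ] := null_lattice_mx pD.
have r1 := enorm_int_ge1 R r0.
have t1 : 1 <= t.
  apply: le_trans (Dt ord0); rewrite DZ col_toR enorm_int_ge1 //.
  apply: contraTN (full_col_rank_col_neq0 ord0 rD) => /eqP Z0.
  by rewrite DZ col_toR Z0 toR0 eqxx.
have [rho rhoE] : exists rho, r *m Z = rho by exists (r *m Z).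
have [rho0|/rV0Pn[s rho_s]] := eqVneq rho 0.
  (* Any [k] of the [k + 1] vectors will do. *)
  exists (colsub (lift ord0) Z); split.
  - rewrite (_ : toR R _ = colsub (lift ord0) D).
      exact: full_col_rank_colsub lift_inj rD.
    by rewrite DZ; apply/matrixP => i j; rewrite !mxE.
  - by rewrite mulmx_colsub pZ; apply/matrixP => i j; rewrite !mxE.
  - by rewrite mulmx_colsub rhoE rho0; apply/matrixP => i j; rewrite !mxE.
  - move=> j; have := Dt (lift ord0 j); rewrite DZ !col_toR.
    rewrite (_ : col j _ = col (lift ord0 j) Z) => [h|]; first nra.
    by apply/matrixP => i l; rewrite !mxE.
pose C := elim_mx rho s.
have colW i : col i (toR R (Z *m C)) = (rho 0 s)%:~R *: col (lift s i) D -
    (rho 0 (lift s i))%:~R *: col s D.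
  rewrite col_toR col_mulmx col_elim_mx mul_elim_vec DZ.
  by apply/matrixP => l j; rewrite !mxE rmorphB !rmorphM.
exists (Z *m C); split.
- rewrite toR_mul -DZ; exact: full_col_rank_mul rD (rank_elim_mx rho_s).
- by rewrite mulmxA pZ mul0mx.
- by rewrite mulmxA rhoE mul_elim_mx.
move=> i; rewrite -(@ler_sqr R) ?nnegrE ?enorm_ge0 //; last by nra.
rewrite colW; apply: le_trans (sqr_enorm_combination _ _ _ _) _.
have rho_le l : (rho 0 l)%:~R ^+ 2 <= (enorm (toR R r) * t) ^+ 2 :> R.
  have := cauchy_schwarz (toR R r) (col l D).
  rewrite DZ col_toR dot_toR -col_mulmx mxE rhoE => h.
  rewrite -[leLHS]real_normK ?num_real // ler_sqr ?nnegrE //; last nra.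
  apply: le_trans h _; rewrite -col_toR -DZ.
  by apply: ler_wpM2l (Dt l); exact: enorm_ge0.
have sqr_le l : enorm (col l D) ^+ 2 <= t ^+ 2.
  by rewrite ler_sqr ?nnegrE ?enorm_ge0 //; lra.
have bound l l' : (rho 0 l)%:~R ^+ 2 * enorm (col l' D) ^+ 2 <=
    (enorm (toR R r) * t) ^+ 2 * t ^+ 2.
  by apply: ler_pM; rewrite ?sqr_ge0.
have := bound s (lift s i); have := bound (lift s i) s; nra.
Qed.

End NullLattices.

(** * Short reduced vectors are orthogonal to [p] *)

Section Reduction.
Variable R : realType.

Lemma reduced_col_le (red : reduction_method R) n cn m s (B : 'M[R]_(m, s)) :
  has_reduction_factor red n cn -> (s <= n)%N -> \rank B = s -> red m s B ->
  forall k (D : 'M[R]_(m, k)) (t : R), 0 <= cn -> 0 <= t -> (k <= s)%N ->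
  \rank D = k -> (forall j, lattice_of B (col j D)) ->
  (forall j, enorm (col j D) <= t) ->
  forall j : 'I_s, (j < k)%N -> enorm (col j B) <= cn * t.
Proof.
move=> hred sn rB redB k D t cn0 t0 ks rD BD Dt j jk.
have ks' : (1 <= k <= s)%N by rewrite ks andbT; lia.
have := hred _ _ _ sn rB redB _ _ ks' rD BD => maxB.
apply: (@le_trans _ _ (cn * \big[Num.max/0]_(j < k) enorm (col j D))).
  apply: le_trans maxB.
  exact: (le_bigmax_cond _ (fun j : 'I_s => enorm (col j B)) jk).
by apply: ler_wpM2l => //; apply: bigmax_le.
Qed.

(** The first vector of a reduced basis is an independent family of one vector,
    to which the basis can be compared: [|b_1| <= cn |b_1|]. *)
Lemma reduction_factor_ge1 (red : reduction_method R) n cn m s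
    (B : 'M[R]_(m, s.+1)) :
  has_reduction_factor red n cn -> (s < n)%N -> \rank B = s.+1 ->
  red m s.+1 B -> 1 <= cn.
Proof.
move=> hred sn rB redB.
pose D : 'M[R]_(m, 1) := colsub (fun=> ord0) B.
have colD j : col j D = col ord0 B by apply/matrixP => i l; rewrite !mxE.
have rD : \rank D = 1%N.
  by apply: full_col_rank_colsub rB => i j _; rewrite !ord1.
have b0 : 0 < enorm (col ord0 B).
  rewrite lt_neqAle enorm_ge0 andbT eq_sym.
  apply: contra_neq (full_col_rank_col_neq0 ord0 rB) => e0.
  apply/matrixP => i j; rewrite ord1 [RHS]mxE.
  have := sqr_enorm_col (col ord0 B); rewrite e0 expr0n /= => /esym/eqP.
  rewrite psumr_eq0 => [/allP/(_ i)|l _]; last exact: sqr_ge0.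
  by rewrite mem_index_enum sqrf_eq0 => /(_ isT)/eqP.
have BD j : lattice_of B (col j D).
  exists (delta_mx ord0 0) => //; rewrite colD colE; congr (_ *m _).
  by apply/matrixP => i l; rewrite !mxE; case: (_ && _).
have := hred _ _ _ sn rB redB 1%N D isT rD BD.
rewrite [X in _ <= _ * X]big_ord_recl big_ord0 colD (_ : Num.max (enorm _) 0 = enorm (col ord0 B)); last first.
  by apply/max_idPl; exact: ltW.
have := @le_bigmax_cond _ _ _ 0 ord0 (fun j : 'I_s.+1 => j < 1)%N
  (fun j : 'I_s.+1 => enorm (col j B)) isT.
move=> h1 h2; have := le_trans h1 h2.
by rewrite -ler_pdivrMr // divff ?gt_eqF.
Qed.

(** The vectors of the null lattice of [a] orthogonal to [p] and [r] that come
    from [D] bound the first [k] reduced vectors [b] by [2 cn |r| t^2].  As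
    [a b = 0] reads [M (p b) = - r b], this makes the integer [p b] smaller
    than 1 in absolute value. *)
Lemma reduced_orthogonal_to_p (red : reduction_method R) n m cn M
    (p r a : 'rV[int]_n) (V : 'M[int]_(n, m)) k (D : 'M[R]_(n, k.+1)) t :
  has_reduction_factor red n cn -> (m <= n)%N -> 0 <= cn ->
  a = M *: p + r -> r != 0 ->
  basis_of_lattice (toR R V) (null_lattice R a) -> red n m (toR R V) ->
  (k <= m)%N -> \rank D = k.+1 -> (forall j, null_lattice R p (col j D)) ->
  (forall j, enorm (col j D) <= t) ->
  2 * cn * enorm (toR R r) ^+ 2 * t ^+ 2 < M%:~R ->
  forall j : 'I_m, (j < k)%N -> (p *m V) 0 j = 0.
Proof.
move=> hred mn cn0 -> r0 hV redV km rD pD Dt hM j jk.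
have [W [rW pW rW0 Wt]] := short_vectors_orthogonal_to_both r0 rD pD Dt.
have t0 : 0 <= t := le_trans (enorm_ge0 _) (Dt ord0).
have nr0 := enorm_ge0 (toR R r).
have [rV VL] := hV.
have bj : enorm (col j (toR R V)) <= cn * (2 * enorm (toR R r) * t ^+ 2).
  have B0 : 0 <= 2 * enorm (toR R r) * t ^+ 2 by rewrite !mulr_ge0 ?sqr_ge0.
  apply: (reduced_col_le hred mn rV redV cn0 B0 km rW) => // l.
  rewrite VL col_toR; exists (col l W) => //=.
  by rewrite -col_mulmx mulmxDl -scalemxAl pW rW0 scaler0 addr0 col0.
have aV : M * (p *m V) 0 j + (r *m V) 0 j = 0.
  have := basis_of_null_lattice hV; rewrite mulmxDl -scalemxAl.
  by move=> /matrixP/(_ 0 j); rewrite [LHS]mxE [X in X + _]mxE [RHS]mxE.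
have rb : ((r *m V) 0 j)%:~R = - (M%:~R * ((p *m V) 0 j)%:~R) :> R.
  by move/eqP: aV; rewrite addrC addr_eq0 => /eqP ->; rewrite rmorphN rmorphM.
have := cauchy_schwarz (toR R r) (col j (toR R V)).
rewrite col_toR dot_toR -col_mulmx mxE rb normrN normrM -col_toR => h.
have M0 : 0 < M%:~R :> R.
  by apply: le_lt_trans hM; rewrite !mulr_ge0 ?sqr_ge0.
rewrite (gtr0_norm M0) in h.
have : M%:~R * `|((p *m V) 0 j)%:~R| < M%:~R * 1 :> R.
  rewrite mulr1; apply: le_lt_trans h (le_lt_trans _ hM).
  apply: le_trans (ler_wpM2l nr0 bj) _; rewrite le_eqVlt; apply/orP; left.
  by apply/eqP; ring.
rewrite ltr_pM2l // -intr_norm (_ : 1 = 1%:~R) // ltr_int.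
move: ((p *m V) 0 j) => z; clear; lia.
Qed.

End Reduction.

(** * The linear programming relaxations *)

Section Relaxations.
Variable R : realType.

Lemma dot_continuous n (c : 'rV[R]_n) :
  continuous (fun v : 'rV[R]_n => dot c v^T).
Proof.
have -> : (fun v : 'rV[R]_n => dot c v^T) =
    \sum_i (fun v : 'rV[R]_n => c 0 i * v 0 i).
  apply/funext => v; rewrite dotE fct_sumE.
  by apply: eq_bigr => i _; rewrite mxE.
apply: (big_ind (fun g : 'rV[R]_n -> R => continuous g)).
- by move=> v; exact: cst_continuous.
- by move=> f g cf cg v; apply: continuousD; [exact: cf|exact: cg].
move=> i _ v; apply: continuousM; first exact: cst_continuous.
exact: coord_continuous.
Qed.

(** The constraint [a x = beta] caps [x_i] by [beta / a_i], so replacing every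
    bound [u_i] by [w_i], the smaller of [u_i] and [beta / a_i], does not change
    the relaxation and makes it compact.  It is nonempty because [a w >= beta],
    so that a multiple of [w] is feasible. *)
Lemma KP_LP_max_attained n (a : 'rV[int]_n) (beta : int) (u : 'I_n -> \bar R)
    (c : 'rV[R]_n) :
  (forall i, 0 < a 0 i) -> 0 < beta ->
  (forall i, u i = +oo%E \/ exists2 m : nat, (0 < m)%N & u i = (m%:R)%:E) ->
  ((beta%:~R)%:E < \sum_(i < n) ((a 0 i)%:~R)%:E * u i)%E ->
  exists2 x, KP_LP a beta u x & forall y, KP_LP a beta u y -> dot c y <= dot c x.
Proof.
move=> a0 b0 hu hbeta.
have aR0 i : 0 < (a 0 i)%:~R :> R by rewrite ltr0z.
have bR0 : 0 < beta%:~R :> R by rewrite ltr0z.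
pose cap i : R := beta%:~R / (a 0 i)%:~R.
pose w i := if ((cap i)%:E <= u i)%E then cap i else fine (u i).
have cap0 i : 0 < cap i by rewrite divr_gt0.
have wu i : ((w i)%:E <= u i)%E.
  by rewrite /w; case: ifP => //; case: (hu i) => [->|[m _ ->]] //=; rewrite leey.
have w0 i : 0 <= w i.
  rewrite /w; case: ifP => _; first exact: ltW.
  by case: (hu i) => [->|[m _ ->]] /=.
have xw x : KP_LP a beta u x -> forall i, 0 <= x i 0 <= w i.
  move=> [ax xu] i; have [-> xi] := xu i; rewrite /w; case: ifPn => ui /=.
    rewrite ler_pdivlMr // -ax dotE (bigD1 i) //= !mxE mulrC lerDl.
    apply: sumr_ge0 => j _; rewrite mxE mulr_ge0 ?(ltW (aR0 j)) //.
    by have [] := xu j.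
  by case: (hu i) xi ui => [->|[m _ ->]]; rewrite ?leey ?lee_fin.
have aw : beta%:~R <= \sum_i (a 0 i)%:~R * w i.
  have [[i ui]|capu] := pselect (exists i, ((cap i)%:E <= u i)%E).
    rewrite (bigD1 i) //= {1}/w ui mulrCA divff ?gt_eqF // mulr1 lerDl.
    by apply: sumr_ge0 => j _; rewrite mulr_ge0 // ltW.
  have uw i : u i = (w i)%:E.
    rewrite /w; case: ifPn => ui; first by case: capu; exists i.
    by case: (hu i) ui => [->|[m _ ->]] //; rewrite leey.
  rewrite -lee_fin -sumEFin; apply: le_trans (ltW hbeta) _.
  by apply: lee_sum => i _; rewrite uw EFinM.
pose A := [set v : 'rV[R]_n | forall i, `[0, w i]%classic (v 0 i)] `&`
  (fun v : 'rV[R]_n => dot (toR R a) v^T) @^-1` [set beta%:~R].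
have AE v : A v <-> KP_LP a beta u v^T.
  split=> [[vw av]|/[dup] vKP [av _]].
    split=> // i; have := vw i; rewrite /= in_itv /= mxE => /andP[-> viw].
    by split=> //; apply: le_trans (wu i); rewrite lee_fin.
  by split=> // i; have := xw _ vKP i; rewrite /= in_itv /= mxE.
have cA : compact A.
  apply: compact_closedI.
    apply: (@rV_compact R n (fun i => `[0, w i]%classic)) => i.
    exact: segment_compact.
  apply: preimage_closed => [v _|]; first exact: dot_continuous.
  exact: closed_eq.
have A0 : A !=set0.
  pose s := \sum_i (a 0 i)%:~R * w i; pose z := beta%:~R / s.
  have s0 : 0 < s := lt_le_trans bR0 aw.
  have z1 : 0 <= z <= 1 by rewrite divr_ge0 ?(ltW bR0) ?(ltW s0) // ler_pdivrMr // mul1r.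
  exists (\row_i (z * w i)); split=> [i|].
    rewrite /= in_itv /= mxE; have := w0 i; case/andP: z1 => z0 z1 wi0.
    by rewrite mulr_ge0 //= ler_piMl.
  rewrite /= dotE -[beta%:~R](@divfK _ s) ?gt_eqF // mulr_sumr.
  by apply: eq_bigr => i _; rewrite !mxE mulrCA.
have [v vA vmax] := compact_EVT_max A0 cA
  (continuous_subspaceT (@dot_continuous n c)).
exists v^T; first by apply/AE/set_mem.
move=> y yKP; have := vmax y^T; rewrite trmxK; apply.
by apply/mem_set/AE; rewrite trmxK.
Qed.

(** The columns of [V] are [n - 1] independent vectors orthogonal to the nonzero
    [a], so they span its real orthogonal complement, and [V l + xb] ranges over
    the whole hyperplane [a x = beta]. *)
Lemma KP_LP_is_image n (a : 'rV[int]_n) (V : 'M[int]_(n, n.-1)) beta u xb :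
  a != 0 -> a *m V = 0 -> \rank (toR R V) = n.-1 -> (a *m xb) 0 0 = beta ->
  forall x, KP_LP a beta u x <->
    exists2 l, KPN_LP V xb u l & x = toR R V *m l + toR R xb.
Proof.
move=> a0 aV rV axb x.
have axbR : toR R a *m toR R xb = (beta%:~R)%:M.
  by rewrite -toR_mul; apply/matrixP => i j; rewrite !ord1 mxE axb !mxE eqxx.
have aVR : toR R a *m toR R V = 0 by rewrite -toR_mul aV toR0.
split=> [[ax xu]|[l lu ->]]; last first.
  split=> //; rewrite /dot mulmxDr mulmxA aVR mul0mx add0r axbR mxE eqxx.
  by rewrite mulr1n.
have aR0 : (toR R a)^T != 0.
  apply: contra_neq a0 => h; apply: (@toR_inj R); rewrite toR0.
  by rewrite -[LHS]trmxK h trmx0.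
have sub : ((toR R V)^T <= kermx (toR R a)^T)%MS.
  by apply/sub_kermxP; rewrite -trmx_mul aVR trmx0.
have rk : \rank (kermx (toR R a)^T) = n.-1.
  rewrite mxrank_ker (_ : \rank _ = 1%N) ?subn1 //.
  apply/eqP; rewrite eqn_leq rank_leq_col lt0n mxrank_eq0 aR0 //.
have eqV : ((toR R V)^T == kermx (toR R a)^T)%MS.
  by rewrite -(mxrank_leqif_eq sub) mxrank_tr rV rk.
have : ((x - toR R xb)^T <= (toR R V)^T)%MS.
  rewrite (eqmxP eqV); apply/sub_kermxP; rewrite -trmx_mul mulmxBr axbR.
  apply/matrixP => i j; rewrite !ord1 !mxE eqxx mulr1n -[beta%:~R]ax /dot mxE.
  by rewrite subrr.
case/submxP => l /(congr1 trmx); rewrite trmxK trmx_mul trmxK => xl.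
have xE : x = toR R V *m l^T + toR R xb by rewrite -xl subrK.
by exists l^T => //; rewrite /KPN_LP /= -xE.
Qed.

Lemma dot_last_unit m (l : 'cV[R]_m.+1) :
  dot (toR R (last_unit m.+1)) l = l ord_max 0.
Proof.
rewrite dotE (bigD1 ord_max) //= !mxE eqxx mul1r big1 ?addr0 // => i im.
rewrite !mxE (_ : (_ == _) = false) ?mul0r //; apply/negbTE.
by apply: contra_neq im => -[im]; apply: val_inj.
Qed.

End Relaxations.

(** * Widths under integral affine maps *)

Section IntervalWidths.
Variable R : realType.
Implicit Types (A : set R) (q c : int).

(** Both bounds have to be attained: [set_max] and [set_min] are 0 on a set
    without a largest or smallest element. *)
Definition spans A (lo hi : R) :=
  [/\ A lo, A hi & forall t, A t -> lo <= t <= hi].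

Lemma spans_max A lo hi : spans A lo hi -> set_max A = hi.
Proof.
move=> [Al Ah Alh]; rewrite /set_max; set S := (X in xget 0 X).
have : S (xget 0 S) by apply: xgetPex; exists hi; split=> // t /Alh/andP[].
move=> [Ax ubx]; apply: le_anti; rewrite (ubx hi Ah) andbT.
by case/andP: (Alh _ Ax).
Qed.

Lemma spans_min A lo hi : spans A lo hi -> set_min A = lo.
Proof.
move=> [Al Ah Alh]; rewrite /set_min; set S := (X in xget 0 X).
have : S (xget 0 S) by apply: xgetPex; exists lo; split=> // t /Alh/andP[].
move=> [Ax lbx]; apply: le_anti; rewrite (lbx lo Al) /=.
by case/andP: (Alh _ Ax).
Qed.

Lemma floor_sub_ceil_geN1 (x y : R) : x <= y -> -1 <= Num.floor y - Num.ceil x.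
Proof.
move=> xy; have := floorD1_gt y; have := ceilB1_lt x => h1 h2.
have : (Num.ceil x - 1)%:~R < (Num.floor y + 1)%:~R :> R.
  exact: lt_trans h1 (le_lt_trans xy h2).
rewrite ltr_int; lia.
Qed.

Lemma floor_sub_ceil_approx (x y : R) :
  y - x - 1 <= (Num.floor y - Num.ceil x + 1)%:~R <= y - x + 1.
Proof.
rewrite rmorphD rmorphB /=; have := floor_itv y; have := ceil_itv x.
by rewrite rmorphB rmorphD /= => /andP[h1 h2] /andP[h3 h4]; apply/andP; split; lra.
Qed.

(** An integral affine map with nonzero slope [q] is injective and sends
    integers to integers, so it cannot lower the number of integers in an
    interval.  When that number is 0 the inequality says that the image does
    not have a negative count, which is [floor_sub_ceil_geN1]. *)
Lemma integral_affine_floor_ceil q c (x y : R) : 0 < q -> x <= y ->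
  Num.floor y - Num.ceil x <=
  Num.floor (q%:~R * y + c%:~R) - Num.ceil (q%:~R * x + c%:~R).
Proof.
move=> q0 xy; have qR0 : 0 < q%:~R :> R by rewrite ltr0z.
have f : q * Num.floor y + c <= Num.floor (q%:~R * y + c%:~R).
  by rewrite floor_ge_int rmorphD rmorphM lerD2r ler_pM2l // floor_le.
have g : Num.ceil (q%:~R * x + c%:~R) <= q * Num.ceil x + c.
  by rewrite ceil_le_int rmorphD rmorphM lerD2r ler_pM2l // ceil_ge.
have h : q%:~R * x + c%:~R <= q%:~R * y + c%:~R by rewrite lerD2r ler_pM2l.
have := floor_sub_ceil_geN1 h; have := floor_sub_ceil_geN1 xy.
move: (Num.floor y) (Num.ceil x) (Num.floor _) (Num.ceil _) f g => f1 c1 f2 c2.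
by nia.
Qed.

Lemma spans_affine_preimage A q c lo hi : q != 0 ->
  spans [set q%:~R * t + c%:~R | t in A] lo hi ->
  exists lo' hi', [/\ spans A lo' hi', hi - lo = `|q|%:~R * (hi' - lo') &
    Num.floor hi' - Num.ceil lo' <= Num.floor hi - Num.ceil lo].
Proof.
move=> q0 [[x Ax <-] [y Ay <-] Axy].
have Axy' t : A t -> q%:~R * x <= q%:~R * t <= q%:~R * y.
  move=> At; have := Axy (q%:~R * t + c%:~R).
  by rewrite !lerD2r; apply; exists t.
(* A negative slope exchanges the two endpoints. *)
have [qpos|qneg|qz] := ltgtP 0 q; last by rewrite -qz eqxx in q0.
  have qR0 : 0 < q%:~R :> R by rewrite ltr0z.
  have sA t : A t -> x <= t <= y by move=> /Axy'; rewrite !ler_pM2l.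
  exists x, y; split=> //; first by rewrite gtr0_norm //; ring.
  by apply: integral_affine_floor_ceil => //; case/andP: (sA _ Ay).
have qR0 : q%:~R < 0 :> R by rewrite ltrz0.
have sA t : A t -> y <= t <= x by move=> /Axy'; rewrite !ler_nM2l // andbC.
exists y, x; split=> //; first by rewrite ltr0_norm // rmorphN /=; ring.
(* The slope [- q] is positive, and negation exchanges floor and ceiling. *)
have yx : - x <= - y by rewrite lerN2; case/andP: (sA _ Ay).
have Nq : 0 < - q by rewrite oppr_gt0.
have := integral_affine_floor_ceil c Nq yx.
by rewrite rmorphN !mulrNN (floorNceil (- y)) (ceilNfloor (- x)) !opprK addrC.
Qed.

End IntervalWidths.

(** * The last coordinate direction *)

Section LastDirection.
Variable R : realType.

Lemma not_parallel_minor n (p r : 'rV[int]_n) :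
  (forall i, 0 < p 0 i) -> ~ parallel (toR R p) (toR R r) ->
  exists i j, p 0 i * r 0 j - p 0 j * r 0 i != 0.
Proof.
case: n p r => [|n] p r p0 npr; apply: contrapT => h; apply: npr.
  by left; exists 0; apply/matrixP => i [].
have pR0 : (p 0 0)%:~R != 0 :> R by rewrite intr_eq0 gt_eqF.
(* If all minors vanish, [r] is [r_1 / p_1] times [p]. *)
right; exists ((r 0 0)%:~R / (p 0 0)%:~R); apply/matrixP => i j.
rewrite !mxE ord1 mulrAC; apply: canRL (mulfK pR0) _.
rewrite -!rmorphM; congr intmul; apply/eqP; rewrite -subr_eq0.
apply: contrapT => /negP h0; apply: h; exists 0, j.
by rewrite mulrC [p 0 j * _]mulrC.
Qed.

(** On [a x = beta] with [x >= 0], [a_i >= M / 2] gives [sum x <= 2 beta / M];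
    hence [M (p x) = beta - r x] is within [2 |r| beta / M] of [beta]. *)
Lemma KP_EQ_spread_le n (p r a : 'rV[int]_n) M beta u (x y : 'cV[R]_n) :
  a = M *: p + r -> (forall i, 0 < p 0 i) -> 0 < M ->
  2 * enorm (toR R r) <= M%:~R -> KP_LP a beta u x -> KP_LP a beta u y ->
  dot (toR R p) x - dot (toR R p) y <=
    4 * enorm (toR R r) * (beta%:~R / M%:~R ^+ 2).
Proof.
move=> aE p0 M0 rM; have MR0 : 0 < M%:~R :> R by rewrite ltr0z.
have nr0 := enorm_ge0 (toR R r).
suff near_beta z : KP_LP a beta u z ->
    `|M%:~R * dot (toR R p) z - beta%:~R| <=
    2 * enorm (toR R r) * (beta%:~R / M%:~R).
  move=> /near_beta + /near_beta; rewrite !ler_norml => /andP[_ hx] /andP[hy _].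
  rewrite -(ler_pM2l MR0) [leRHS](_ : _ = 4 * enorm (toR R r) * (beta%:~R / M%:~R)).
    by lra.
  by field; rewrite gt_eqF.
move=> [az zu].
have -> : M%:~R * dot (toR R p) z - beta%:~R = - dot (toR R r) z.
  rewrite -az aE !dotE mulr_sumr -sumrB -sumrN; apply: eq_bigr => i _.
  by rewrite !mxE rmorphD rmorphM /=; ring.
rewrite normrN dotE; apply: le_trans (ler_norm_sum _ _ _) _.
rewrite (_ : _ * _ = \sum_i 2 * enorm (toR R r) / M%:~R * ((a 0 i)%:~R * z i 0)).
  apply: ler_sum => i _; have [zi0 _] := zu i.
  rewrite normrM (ger0_norm zi0) mulrA; apply: ler_wpM2r => //.
  have ri := norm_entry_le (toR R r) i; apply: le_trans ri _.
  rewrite mulrAC ler_pdivlMr // [leRHS]mulrAC [leRHS]mulrC.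
  apply: ler_wpM2l => //; move: (norm_entry_le (toR R r) i).
  rewrite mxE aE !mxE rmorphD rmorphM /= ler_norml => /andP[ri' _].
  have : 1 <= (p 0 i)%:~R :> R by rewrite (_ : 1 = 1%:~R) // ler_int -gtz0_ge1.
  by nra.
rewrite -mulr_sumr -az dotE [RHS](_ : _ =
  2 * enorm (toR R r) / M%:~R * \sum_i toR R a 0 i * z i 0); first by ring.
by congr (_ * _); apply: eq_bigr => i _; rewrite mxE.
Qed.

Lemma KP_EQ_vertex n (a : 'rV[int]_n) beta (u : 'I_n -> \bar R) i :
  (forall i, 0 < a 0 i) -> 0 < beta -> (forall i, u i = +oo%E) ->
  KP_LP a beta u ((beta%:~R / (a 0 i)%:~R) *: delta_mx i 0).
Proof.
move=> a0 b0 uoo; have aR0 : (a 0 i)%:~R != 0 :> R by rewrite intr_eq0 gt_eqF.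
split; last first.
  move=> j; rewrite uoo leey !mxE mulr_ge0 // ?ler0n //.
  by rewrite divr_ge0 ?ler0z ?ltW.
by rewrite /dot -scalemxAr -colE !mxE divfK.
Qed.

(** [a_j e_i - a_i e_j] lies in the null lattice of [a], and [p] takes on it
    the value [p_i r_j - p_j r_i], whatever [M] is.  If [p] vanishes on all
    basis vectors but the last, this value is a multiple of the last entry. *)
Lemma last_entry_dvd_minor m M (p r a : 'rV[int]_m.+2) (V : 'M[int]_(m.+2, m.+1)) :
  a = M *: p + r -> basis_of_lattice (toR R V) (null_lattice R a) ->
  (forall j : 'I_m.+1, (j < m)%N -> (p *m V) 0 j = 0) ->
  forall i j, exists z, p 0 i * r 0 j - p 0 j * r 0 i = (p *m V) 0 ord_max * z.
Proof.
move=> aE [_ VL] pV i j; pose v := elim_vec a j i.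
have : null_lattice R a (toR R v).
  exists v => //=; rewrite mul_elim_vec; apply/matrixP => k l.
  by rewrite !mxE ord1 mulrC subrr.
rewrite -VL => -[z _]; rewrite -toR_mul => /toR_inj Vz.
exists (z ord_max 0).
have : (p *m v) 0 0 = (p *m V *m z) 0 0 by rewrite -mulmxA Vz.
rewrite mul_elim_vec aE [in LHS]mxE.
rewrite [X in _ = X]mxE (bigD1 ord_max) //= big1 ?addr0 => [<-|l lm].
  by rewrite !mxE; ring.
rewrite pV ?mul0r // ltn_neqAle -ltnS ltn_ord andbT.
by apply: contra_neq lm => lm; apply: val_inj.
Qed.

Lemma values_of_p m (p a : 'rV[int]_m.+2) (V : 'M[int]_(m.+2, m.+1)) beta
    (u : 'I_m.+2 -> \bar R) xb :
  a != 0 -> a *m V = 0 -> \rank (toR R V) = m.+1 -> (a *m xb) 0 0 = beta ->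
  (forall j : 'I_m.+1, (j < m)%N -> (p *m V) 0 j = 0) ->
  [set dot (toR R p) x | x in KP_LP a beta u] =
  [set ((p *m V) 0 ord_max)%:~R * t + ((p *m xb) 0 0)%:~R
     | t in [set dot (toR R (last_unit m.+1)) l | l in KPN_LP V xb u]].
Proof.
move=> a0 aV rV axb pV.
have eval l : dot (toR R p) (toR R V *m l + toR R xb) =
    ((p *m V) 0 ord_max)%:~R * l ord_max 0 + ((p *m xb) 0 0)%:~R.
  rewrite -dot_toR /dot mulmxDr mulmxA -toR_mul [LHS]mxE; congr (_ + _).
  rewrite mxE (bigD1 ord_max) //= mxE big1 ?addr0 // => j jm.
  rewrite mxE pV ?mul0r // ltn_neqAle -ltnS ltn_ord andbT.
  by apply: contra_neq jm => jm; apply: val_inj.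
have KPE := @KP_LP_is_image R m.+2 a V beta u xb a0 aV rV axb.
apply/seteqP; split=> [_ [x /KPE[l lu ->] <-]|_ [_ [l lu <-] <-]].
  by exists (l ord_max 0); [exists l => //; exact: dot_last_unit|rewrite eval].
by exists (toR R V *m l + toR R xb); [apply/KPE; exists l|rewrite eval dot_last_unit].
Qed.

(** Upper bound: the spread of [p]. Lower bound: two vertices of the simplex
    [a x = beta], [x >= 0] are [beta |p_i r_j - p_j r_i| / (a_i a_j)] apart in
    the direction [p], and dividing by the last entry [q] of [p V], a divisor
    of the minor, leaves at least [beta / (a_i a_j)]. *)
Lemma last_width_bounds m M (p r a : 'rV[int]_m.+2) (V : 'M[int]_(m.+2, m.+1))
    beta (u : 'I_m.+2 -> \bar R) i j (lo hi lo' hi' : R) :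
  a = M *: p + r -> (forall i, 0 < p 0 i) -> (forall i, 0 < a 0 i) ->
  0 < M -> 2 * enorm (toR R r) <= M%:~R -> 0 < beta ->
  (forall i, u i = +oo%E) ->
  basis_of_lattice (toR R V) (null_lattice R a) ->
  (forall j : 'I_m.+1, (j < m)%N -> (p *m V) 0 j = 0) ->
  p 0 i * r 0 j - p 0 j * r 0 i != 0 ->
  spans [set dot (toR R p) x | x in KP_LP a beta u] lo hi ->
  lo' <= hi' -> hi - lo = `|(p *m V) 0 ord_max|%:~R * (hi' - lo') ->
  (4 * (p 0 i)%:~R * (p 0 j)%:~R)^-1 * (beta%:~R / M%:~R ^+ 2) <= hi' - lo' <=
    4 * enorm (toR R r) * (beta%:~R / M%:~R ^+ 2).
Proof.
move=> aE p0 a0 M0 rM b0 uoo hV pV dij [[x xKP <-] [y yKP <-] xy] lohi Wq.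
have [z zq] := last_entry_dvd_minor aE hV pV i j.
set q := (p *m V) 0 ord_max in Wq zq.
have q1 : 1 <= `|q|%:~R :> R.
  rewrite (_ : 1 = 1%:~R) // ler_int -gtz0_ge1 normr_gt0.
  by apply: contraNneq dij => q0; rewrite zq q0 mul0r.
apply/andP; split; last first.
  have := KP_EQ_spread_le aE p0 M0 rM yKP xKP; rewrite Wq.
  have : 0 <= hi' - lo' by rewrite subr_ge0.
  by nra.
have vi := KP_EQ_vertex i a0 b0 uoo; have vj := KP_EQ_vertex j a0 b0 uoo.
have MR0 : 0 < M%:~R :> R by rewrite ltr0z.
have bR0 : 0 < beta%:~R :> R by rewrite ltr0z.
have aR0 l : 0 < (a 0 l)%:~R :> R by rewrite ltr0z.
have pR1 l : 1 <= (p 0 l)%:~R :> R by rewrite (_ : 1 = 1%:~R) // ler_int -gtz0_ge1.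
(* [|r_l| <= M / 2 <= M p_l] *)
have aM l : (a 0 l)%:~R <= 2 * M%:~R * (p 0 l)%:~R :> R.
  have := norm_entry_le (toR R r) l; have := pR1 l.
  rewrite aE !mxE rmorphD rmorphM /= ler_norml => h /andP[_].
  by nra.
have valv l : dot (toR R p) ((beta%:~R / (a 0 l)%:~R) *: delta_mx l 0) =
    beta%:~R * (p 0 l)%:~R / (a 0 l)%:~R.
  by rewrite /dot -scalemxAr -colE !mxE mulrAC.
have diff : `|(p 0 i)%:~R * (r 0 j)%:~R - (p 0 j)%:~R * (r 0 i)%:~R|
    * (beta%:~R / ((a 0 i)%:~R * (a 0 j)%:~R)) <= `|q|%:~R * (hi' - lo') :> R.
  rewrite -Wq.
  have c0 : 0 < beta%:~R / ((a 0 i)%:~R * (a 0 j)%:~R) :> R.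
    by rewrite divr_gt0 ?mulr_gt0.
  rewrite -[X in _ * X <= _](gtr0_norm c0) -normrM.
  rewrite (_ : (_ - _) * _ =
    beta%:~R * (p 0 i)%:~R / (a 0 i)%:~R - beta%:~R * (p 0 j)%:~R / (a 0 j)%:~R).
    have := xy _ (ex_intro2 _ _ _ vi erefl).
    have := xy _ (ex_intro2 _ _ _ vj erefl); rewrite !valv.
    move: (_ / (a 0 i)%:~R) (_ / (a 0 j)%:~R) => vali valj.
    by rewrite ler_norml => /andP[? ?] /andP[? ?]; apply/andP; split; lra.
  have := aR0 i; have := aR0 j; rewrite aE !mxE !rmorphD !rmorphM /= => *.
  by field; rewrite !gt_eqF.
have : `|q|%:~R <= `|(p 0 i)%:~R * (r 0 j)%:~R - (p 0 j)%:~R * (r 0 i)%:~R| :> R.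
  rewrite -!rmorphM -rmorphB /= -intr_norm ler_int zq normrM.
  by rewrite ler_peMr // -gtz0_ge1 normr_gt0; apply: contraNneq dij => z0; rewrite zq z0 mulr0.
move=> qd; have {}diff : beta%:~R / ((a 0 i)%:~R * (a 0 j)%:~R) <= hi' - lo'.
  rewrite -(ler_pM2l (lt_le_trans ltr01 q1)); apply: le_trans diff.
  by apply: ler_wpM2r qd; rewrite divr_ge0 ?mulr_ge0 // ltW.
apply: le_trans diff; rewrite mulrCA; apply: ler_wpM2l; first exact: ltW.
rewrite -invfM lef_pV2 ?posrE ?mulr_gt0 ?exprn_gt0 //; last 2 first.
- exact: lt_le_trans ltr01 (pR1 i).
- exact: lt_le_trans ltr01 (pR1 j).
apply: le_trans (ler_pM (ltW (aR0 i)) (ltW (aR0 j)) (aM i) (aM j)) _.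
by rewrite le_eqVlt; apply/orP; left; apply/eqP; ring.
Qed.

End LastDirection.

Theorem theorem11 (R : realType) (n : nat) (p r : 'rV[int]_n)
    (hp : forall i, 0 < p 0 i)
    (hpr : ~ parallel (toR R p) (toR R r)) :
  exists c1 c2 K : R, [/\ 0 < c1, 0 < c2 & 0 < K] /\
  forall (M : int) (a : 'rV[int]_n) (ha : a = M *: p + r)
    (ha0 : forall i, 0 < a 0 i)
    (u : 'I_n -> \bar R)
    (hu : forall i, u i = +oo%E \/
                    exists2 m : nat, (0 < m)%N & u i = (m%:R)%:E)
    (beta : int) (hbeta0 : 0 < beta)
    (hbeta : ((beta%:~R)%:E < \sum_(i < n) ((a 0 i)%:~R)%:E * u i)%E)
    (red : reduction_method R) (cn : R)
    (hred : has_reduction_factor red n cn)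
    (V : 'M[int]_(n, n.-1))
    (hV : basis_of_lattice (toR R V) (null_lattice R a))
    (hVred : red n n.-1 (toR R V))
    (xb : 'cV[int]_n) (hxb : (a *m xb) 0 0 = beta),
  (forall k : nat, (1 <= k <= n - 2)%N ->
     2 * cn * enorm (toR R r) ^+ 2 * succ_min k.+1 (null_lattice R p) ^+ 2
       < M%:~R ->
     (forall j : 'I_n.-1, (j < k)%N -> (p *m V) 0 j = 0) /\
     (infeasible_by_branching_on p (KP_LP a beta u) ->
      infeasible_by_branching_from k (KPN_LP V xb u)))
  /\
  (2 * cn * enorm (toR R r) ^+ 2 * enorm (toR R p) ^+ 2 < M%:~R ->
   [/\ forall j : 'I_n.-1, (j < n - 2)%N -> (p *m V) 0 j = 0,
       width (last_unit n.-1) (KPN_LP V xb u) <= width p (KP_LP a beta u),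
       iwidth (last_unit n.-1) (KPN_LP V xb u) <= iwidth p (KP_LP a beta u)
     & (forall i, u i = +oo%E) ->
       let t := beta%:~R / M%:~R ^+ 2 in
       c1 * t <= width (last_unit n.-1) (KPN_LP V xb u) <= c2 * t /\
       (K <= t ->
        c1 * t <= (iwidth (last_unit n.-1) (KPN_LP V xb u))%:~R <= c2 * t)]).
Proof.
have [i0 [j0 dij]] := not_parallel_minor hp hpr.
case: n => [|[|m]] in p r hp hpr i0 j0 dij *.
- by case: (i0).
- by rewrite !ord1 subrr eqxx in dij.
have pR1 i : 1 <= (p 0 i)%:~R :> R by rewrite (_ : 1 = 1%:~R) // ler_int -gtz0_ge1.
pose P : R := (p 0 i0)%:~R * (p 0 j0)%:~R.
have P1 : 1 <= P by have := pR1 i0; have := pR1 j0; rewrite /P; nra.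
have nr0 := enorm_ge0 (toR R r).
(* The width lies between [t / (4 P)] and [4 |r| t]. For the integer width,
   which differs from it by at most 1, the lower constant is halved and the
   upper one is increased by 1; both steps need [1 <= t / (8 P)]. *)
exists (8 * P)^-1, (4 * enorm (toR R r) + 1), (8 * P).
split; first by split; rewrite ?invr_gt0; lra.
move=> M a aE a0 u hu beta b0 hbeta red cn hred /= V hV redV xb axb.
have r0 : r != 0 by apply: contraNneq dij => ->; rewrite !mxE !mulr0 subrr.
have nr1 := enorm_int_ge1 R r0.
have [rV VL] := hV; have aV := basis_of_null_lattice hV.
have cn1 := reduction_factor_ge1 hred (leqnSn m.+1) rV redV.
have cn0 : 0 <= cn := le_trans ler01 cn1.
have a_neq0 : a != 0.
  by apply: contraTneq (a0 0) => ->; rewrite mxE ltxx.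
have KPE := @KP_LP_is_image R m.+2 a V beta u xb a_neq0 aV rV axb.
pose D := toR R (elim_mx p ord_max).
have rD : \rank D = m.+1 by apply: rank_elim_mx; rewrite gt_eqF.
have pD j : null_lattice R p (col j D).
  rewrite col_toR; exists (col j (elim_mx p ord_max)) => //=.
  by rewrite -col_mulmx mul_elim_mx col0.
have branching k : (forall j : 'I_m.+1, (j < k)%N -> (p *m V) 0 j = 0) ->
    infeasible_by_branching_on p (KP_LP a beta u) ->
    infeasible_by_branching_from k (KPN_LP V xb u).
  move=> pV0 noint [l [lu lint]].
  have /noint/negP[] : KP_LP a beta u (toR R V *m l + toR R xb).
    by apply/KPE; exists l.
  rewrite /dot mulmxDr mulmxA -!toR_mul mxE [X in _ + X]mxE.
  rewrite mxE rpredD ?intr_int //; apply: rpred_sum => j _; rewrite mxE.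
  have [jk|kj] := ltnP j k; first by rewrite pV0 // mul0r rpred0.
  by rewrite rpredM ?intr_int ?lint.
split=> [k /andP[k1 km] hM|hM].
  have km' : (k <= m)%N by rewrite subn2 in km.
  (* The first [k + 1] columns of [D] show that the minimum is over a nonempty
     set. *)
  have [||E [rE pE Et]] := @succ_min_attained R _ k p
      (colsub (widen_ord (km' : (k < m.+1)%N)) D).
  - by apply: full_col_rank_colsub rD => i j /(congr1 val)/= ij; apply: val_inj.
  - move=> j; have := pD (widen_ord (km' : (k < m.+1)%N) j).
    by congr null_lattice; apply/matrixP => l o; rewrite !mxE.
  have pV0 := reduced_orthogonal_to_p hred (leqnSn _) cn0 aE r0 hV redV
    (leqW km') rE pE Et hM.
  by split=> //; exact: branching.
have pV0 : forall j : 'I_m.+1, (j < m)%N -> (p *m V) 0 j = 0.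
  exact: (reduced_orthogonal_to_p hred (leqnSn _) cn0 aE r0 hV redV (leqnSn m)
    rD pD (enorm_elim_mx R p ord_max) hM).
have np1 : 1 <= enorm (toR R p).
  by apply: enorm_int_ge1; apply: contraTneq (hp 0) => ->; rewrite mxE ltxx.
(* All of [cn], [|r|] and [|p|] are at least 1. *)
have rM : 2 * enorm (toR R r) <= M%:~R.
  apply: le_trans (ltW hM); rewrite -[leLHS]mulr1.
  have h1 : 1 <= enorm (toR R p) ^+ 2 by rewrite exprn_ege1.
  have h2 : enorm (toR R r) <= enorm (toR R r) ^+ 2 by rewrite ler_eXnr.
  apply: ler_pM => //; first by rewrite mulr_ge0.
  by rewrite -mulrA ler_pM2l //; nra.
have M0 : 0 < M by rewrite -(ltr0z R); lra.
have [x xKP xmax] := KP_LP_max_attained (toR R p) a0 b0 hu hbeta.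
(* The minimum of [p] is the maximum of [- p]. *)
have [y yKP ymin] := KP_LP_max_attained (- toR R p) a0 b0 hu hbeta.
have spanS : spans [set dot (toR R p) x | x in KP_LP a beta u]
    (dot (toR R p) y) (dot (toR R p) x).
  split; [by exists y|by exists x|move=> _ [w wKP <-]].
  by rewrite xmax // andbT; have := ymin w wKP; rewrite /dot !mulNmx !mxE lerN2.
have q0 : (p *m V) 0 ord_max != 0.
  have [z zq] := last_entry_dvd_minor aE hV pV0 i0 j0.
  by apply: contraNneq dij => q0; rewrite zq q0 mul0r.
have := spanS; rewrite (values_of_p u a_neq0 aV rV axb pV0).
move=> /(spans_affine_preimage q0)[lo' [hi' [spanT Wq countle]]].
have lohi : lo' <= hi' by case: spanT => [Tl Th /(_ _ Tl)/andP[]].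
have WN : width (last_unit m.+1) (KPN_LP V xb u) = hi' - lo'.
  by rewrite /width /max_over /min_over (spans_max spanT) (spans_min spanT).
have IN : iwidth (last_unit m.+1) (KPN_LP V xb u) =
    Num.floor hi' - Num.ceil lo' + 1.
  by rewrite /iwidth /max_over /min_over (spans_max spanT) (spans_min spanT).
split=> //.
- move=> j; rewrite subn2; exact: pV0.
- rewrite [leLHS]WN /width /max_over /min_over (spans_max spanS) (spans_min spanS).
  rewrite Wq ler_peMl ?subr_ge0 // (_ : 1 = 1%:~R) // ler_int.
  by rewrite -gtz0_ge1 normr_gt0.
- rewrite [leLHS]IN /iwidth /max_over /min_over (spans_max spanS).
  by rewrite (spans_min spanS) lerD2r.
move=> uoo; set t := _ / M%:~R ^+ 2; rewrite [width _ _]WN [iwidth _ _]IN.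
have := last_width_bounds aE hp a0 M0 rM b0 uoo hV pV0 dij spanS lohi Wq.
rewrite -/t -mulrA -/P => /andP[tl tu].
have t0 : 0 <= t by rewrite divr_ge0 ?sqr_ge0 // ler0z ltW.
have halve : (4 * P)^-1 * t = 2 * ((8 * P)^-1 * t).
  by field; rewrite gt_eqF //; lra.
have s0 : 0 <= (8 * P)^-1 * t by rewrite mulr_ge0 // invr_ge0; lra.
split; first by apply/andP; split; lra.
move=> Kt; have s1 : 1 <= (8 * P)^-1 * t.
  by rewrite mulrC ler_pdivlMr ?mul1r //; lra.
have /andP[fl fu] := floor_sub_ceil_approx lo' hi'.
by apply/andP; split; lra.
Qed.
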